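(* Let $K>1$, $\theta\in(-\pi/2,\pi/2]$ and $H(z)=h_{K,\theta}(z)^2$. If $H$ has exactly one fixed ray $R_\phi$, then $\bigcup_{k=0}^\infty H^{-k}(R_\phi)$ is dense in $\mathbb{C}$. If $H$ has exactly two or exactly three fixed rays, then the basin of attraction $\Lambda$ of the fixed ray that is not locally repelling is dense in $\mathbb{C}$.
   Context: For $K>1$ and $\theta\in(-\pi/2,\pi/2]$, $h_{K,\theta}(z)=\frac{K+1}{2}z+e^{2i\theta}\frac{K-1}{2}\overline{z}$. A ray is a set $R_\varphi=\{te^{i\varphi}:t\ge 0\}$. The map $H=h_{K,\theta}^2$ sends rays to rays, and induces a map $\widetilde H:\mathbb{R}/2\pi\mathbb{Z}\to\mathbb{R}/2\pi\mathbb{Z}$ by $\widetilde H(\varphi)=\arg H(re^{i\varphi})$ (any $r>0$). A ray $R_\phi$ is fixed by $H$ if $\widetilde H(\phi)=\phi$; it is locally repelling if $\widetilde H'(\phi)>1$. When $H$ has two or three fixed rays, exactly one of them, say $R_{\phi_0}$, is not locally repelling, and its basin of attraction is $\Lambda=\bigcup\{R_\varphi:\widetilde H^n(\varphi)\to\phi_0\text{ as }n\to\infty\}\subset\mathbb{C}$. $H^{-k}$ denotes the preimage under the $k$-th iterate. *)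

(* Defs.v *)
From HB Require Import structures.
From mathcomp Require Import all_boot all_order all_algebra generic_quotient.
From mathcomp Require Import all_classical all_reals all_analysis.
From mathcomp Require Import complex.

Set Implicit Arguments.
Unset Strict Implicit.
Unset Printing Implicit Defensive.

Import Order.TTheory GRing.Theory Num.Theory.
Import numFieldNormedType.Exports.

Local Open Scope classical_set_scope.
Local Open Scope ring_scope.
Local Open Scope complex_scope.
Local Open Scope quotient_scope.

(* R[i] has no topology in the library; this is the one given by its modulus. *)
HB.instance Definition _ (R : realType) :=
  PseudoPointedMetric.copy R[i] (R[i])^o.

Section circle.
Variable R : realType.

Definition mod2pi (x y : R) : bool :=
  `[< exists k : int, x - y = k%:~R * (2 * pi) >].

Lemma mod2pi_refl : reflexive mod2pi.
Proof. by move=> x; apply/asboolP; exists 0; rewrite subrr mul0r. Qed.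

Lemma mod2pi_sym : symmetric mod2pi.
Proof.
suff H x y : mod2pi x y -> mod2pi y x by move=> x y; apply/idP/idP; exact: H.
move=> /asboolP[k xyk]; apply/asboolP; exists (- k).
by rewrite -opprB xyk intrN mulNr.
Qed.

Lemma mod2pi_trans : transitive mod2pi.
Proof.
move=> y x z /asboolP[k xyk] /asboolP[l yzl]; apply/asboolP; exists (k + l).
by rewrite intrD mulrDl -xyk -yzl addrA subrK.
Qed.

Canonical mod2pi_equiv :=
  EquivRel mod2pi mod2pi_refl mod2pi_sym mod2pi_trans.

(* R / 2 pi Z, with the quotient topology. *)
Definition circle : Type := {eq_quot mod2pi}.
HB.instance Definition _ := Topological.copy circle (quotient_topology circle).
HB.instance Definition _ := Quotient.on circle.

Definition angle (t : R) : circle := \pi_circle t.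

End circle.

Section rays.
Variable R : realType.

Definition expi (t : R) : R[i] := cos t +i* sin t.

(* The class of all real arguments of z; meaningful for z != 0 only. *)
Definition arg (z : R[i]) : circle R :=
  angle (xget 0 [set t : R | z = `|z| * expi t]).

Definition ray (phi : circle R) : set R[i] :=
  [set z | exists2 t : R, 0 <= t & z = t%:C * expi (repr phi)].

(* Derivative of a self-map of the circle: the derivative of a local lift to
   the real line. Two local lifts differentiable at t differ by a constant
   near t, so d does not depend on the lift. *)
Definition is_circle_derive (f : circle R -> circle R) (phi : circle R)
    (d : R) : Prop :=
  exists (t : R) (F : R -> R),
    [/\ phi = angle t, \forall s \near t, f (angle s) = angle (F s)
      & is_derive t 1 F d].

End rays.

Section quadratic_map.
Variable R : realType.
Variables K theta : R.

Definition hmap (z : R[i]) : R[i] :=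
  ((K + 1) / 2)%:C * z + expi (2 * theta) * ((K - 1) / 2)%:C * z^*.

Definition Hmap (z : R[i]) : R[i] := hmap z ^+ 2.

Definition Htilde (phi : circle R) : circle R := arg (Hmap (expi (repr phi))).

Definition fixed_rays : set (set R[i]) :=
  [set ray phi | phi in [set phi | Htilde phi = phi]].

Definition locally_repelling (phi : circle R) : Prop :=
  exists2 d : R, is_circle_derive Htilde phi d & 1 < d.

Definition basin (phi0 : circle R) : set R[i] :=
  \bigcup_(phi in [set phi | iter n Htilde phi @[n --> \oo] --> phi0]) ray phi.

End quadratic_map.

(* Main.v *)
Require Import Defs.
From mathcomp Require Import all_boot all_order all_algebra generic_quotient.
From mathcomp Require Import all_classical all_reals all_analysis.
From mathcomp Require Import complex.
From mathcomp Require Import ring lra.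
Set Implicit Arguments.
Unset Strict Implicit.
Unset Printing Implicit Defensive.
Import Order.TTheory GRing.Theory Num.Theory.
Import numFieldNormedType.Exports.
Local Open Scope classical_set_scope.
Local Open Scope ring_scope.
Local Open Scope card_scope.

(** In angular coordinates Htilde is a degree two circle map (on the unit circle
    it is a Blaschke product of degree two), and the theorem is about its
    dynamics. Everything is read in a coordinate that sends a chosen fixed
    direction to infinity. If t is the argument of a fixed direction, every other
    direction is that of e^{it} (y - i)^2 for exactly one real y, and in this
    coordinate Htilde becomes the real rational map
                   f(y) = lam (y - 1/y) + d,
    whose only finite pole is 0 (lemma Htilde_chart). The multiplier of Htilde at
    the chosen fixed direction is 1/lam (locally_repellingP), and the other fixed
    directions are the roots of (1 - lam) y^2 - d y + lam.

    Locating the fixed directions. If y is a fixed point of f, the number lam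
    belonging to that second direction is y^2 / (lam (1 + y^2))
    (stretch_chart). So two distinct fixed directions have multipliers whose
    product exceeds 1, at most one of them is not repelling; and if there are at
    least two, the quadratic root of larger absolute value gives one that is not
    repelling (exists_nonrepelling). If there is just one, the quadratic has no real root,
    which leaves lam = 1 and d = 0, or lam < 1 and a negative discriminant.

    Density when lam >= 1. Then f' = lam (1 + 1/y^2) > 1. An interval whose
    forward images all miss the pole 0 keeps growing, and its length gains a
    definite amount each time one of its ends returns to a bounded region. The
    lengths of the two halves would then become unbounded, and at a return of the
    midpoint one half would have to contain 0. Hence every interval contains a
    point whose orbit hits the pole, that is, reaches the fixed direction, or
    tends to infinity, that is, converges to it (expanding_dense). This is the
    density of the basin. For lam = 1 and d = 0 an orbit that misses the pole
    cannot tend to infinity, because |f(y)| <= |y| as soon as |y| >= 1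
    (triple_bounded), and so the backward orbit of the pole is dense.

    Density when lam < 1 and there is no other fixed direction. The quadratic has
    a complex root in the upper half-plane, a fixed point of the Blaschke product
    inside the disc, and f expands the harmonic measure seen from that point by a
    factor bounded away from 1. That measure is finite, so every interval must
    meet the backward orbit of the pole (elliptic_dense).

    Finally H maps rays to rays, and a set of directions that is dense in the
    coordinate y spans a dense union of rays (dense_rays). *)

(** * The map lam (y - 1/y) + d on the real line *)

(** Up to dilation and translation, the Boole transformation x - 1/x. The value d
    that the convention 0^-1 = 0 gives at the pole is immaterial: an orbit is of
    interest only until it first meets 0. *)
Definition boole {R : realType} (lam d x : R) : R := lam * (x - x^-1) + d.

(** Under this condition every iterate of [a, b] is again an interval, whose ends
    are the iterates of a and b: see misses_pole_boole. *)
Definition misses_pole {R : realType} (lam d a b : R) : Prop :=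
  a < b /\ forall x n, a <= x <= b -> iter n (boole lam d) x != 0.

Lemma booleB (R : realType) (lam d a b : R) : a != 0 -> b != 0 ->
  boole lam d b - boole lam d a = lam * (b - a) * (1 + (a * b)^-1).
Proof. by move=> a0 b0; rewrite /boole; field; rewrite a0 b0. Qed.

Lemma boole_incr (R : realType) (lam d a b : R) : 0 < lam -> 0 < a * b ->
  (boole lam d a <= boole lam d b) = (a <= b).
Proof.
move=> lam0 ab0.
have a0 : a != 0 by apply: contraTneq ab0 => ->; rewrite mul0r ltxx.
have b0 : b != 0 by apply: contraTneq ab0 => ->; rewrite mulr0 ltxx.
rewrite -subr_ge0 booleB// pmulr_lge0 ?pmulr_rge0 ?subr_ge0//.
by rewrite addr_gt0// invr_gt0.
Qed.

(** Each open half-line is mapped onto the whole real line: the two preimages of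
    a point solve a quadratic equation whose roots have product -1. *)
Lemma boole_branch (R : realType) (lam d a y : R) : 0 < lam -> a != 0 ->
  exists2 x, 0 < a * x & boole lam d x = y.
Proof.
move=> lam0 a0.
pose u := (y - d) / lam; pose r := Num.sqrt (u ^+ 2 + 4).
have r2 : r ^+ 2 = u ^+ 2 + 4 by rewrite sqr_sqrtr// addr_ge0 ?sqr_ge0.
have r0 : 0 <= r by rewrite sqrtr_ge0.
have ur : `|u| < r.
  rewrite -(ltr_pXn2r (_ : 0 < 2)%N) ?nnegrE// real_normK ?num_real//.
  by rewrite r2 ltrDl.
have lamn0 := lt0r_neq0 lam0.
have key s : s ^+ 2 = u ^+ 2 + 4 -> u + s != 0 ->
    boole lam d ((u + s) / 2) = y.
  move=> s2 us.
  have -> : boole lam d ((u + s) / 2) =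
      lam * u + d + lam * (s ^+ 2 - u ^+ 2 - 4) / (2 * (u + s)).
    by rewrite /boole; field.
  have -> : s ^+ 2 - u ^+ 2 - 4 = 0 by rewrite s2; ring.
  by rewrite mulr0 mul0r addr0 /u; field.
move: ur; rewrite ltr_norml => /andP[ur1 ur2].
have [a1|a1] : a < 0 \/ 0 < a by apply/orP; rewrite -neq_lt.
- exists ((u - r) / 2); last by apply: key; [rewrite sqrrN|lra].
  by rewrite nmulr_rgt0 //; lra.
- exists ((u + r) / 2); last by apply: key; [|lra].
  by rewrite pmulr_rgt0//; lra.
Qed.

Lemma misses_pole_sign (R : realType) (lam d a b : R) :
  misses_pole lam d a b -> 0 < a * b.
Proof.
move=> [ab m].
have H x : a <= x <= b -> x != 0 by move=> /(m x 0%N).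
have a0 : a != 0 by apply: H; rewrite lexx ltW.
have b0 : b != 0 by apply: H; rewrite lexx ltW.
have [ap|an] := ltP 0 a; first by rewrite mulr_gt0// (lt_trans ap).
have [bp|bn] := ltP b 0; first by rewrite nmulr_rgt0// lt_neqAle a0.
by have := H 0; rewrite an bn eqxx => /(_ isT).
Qed.

(** A point between f(a) and f(b) pulls back into [a, b] along the branch that
    keeps the sign of a, so its orbit cannot meet 0 either. *)
Lemma misses_pole_boole (R : realType) (lam d a b : R) : 0 < lam ->
  misses_pole lam d a b ->
  misses_pole lam d (boole lam d a) (boole lam d b).
Proof.
move=> lam0 mab; have ab0 := misses_pole_sign mab.
case: mab => ab m.
have a0 : a != 0 by apply: contraTneq ab0 => ->; rewrite mul0r ltxx.
split.
  by rewrite ltNge boole_incr// 1?mulrC// -ltNge.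
move=> y n /andP[ay yb].
have [x ax xy] := boole_branch d y lam0 a0.
have bx : 0 < x * b.
  have : 0 < (a * x) * (a * b) by exact: mulr_gt0.
  have -> : a * x * (a * b) = a ^+ 2 * (x * b) by ring.
  by rewrite pmulr_rgt0// exprn_even_gt0.
have := m x n.+1; rewrite iterSr xy; apply.
by rewrite -(boole_incr d lam0 ax) -(boole_incr d lam0 bx) xy ay.
Qed.

Lemma misses_pole_iter (R : realType) (lam d a b : R) n : 0 < lam ->
  misses_pole lam d a b ->
  misses_pole lam d (iter n (boole lam d) a) (iter n (boole lam d) b).
Proof. by move=> l0 m; elim: n => //= n; exact: misses_pole_boole. Qed.

Definition orbit_unbounded {R : realType} (lam d x : R) : Prop :=
  forall M, exists N, forall n, (N <= n)%N -> M < `|iter n (boole lam d) x|.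

Lemma orbit_recurs (R : realType) (lam d x : R) : ~ orbit_unbounded lam d x ->
  exists M, forall N, exists2 n, (N <= n)%N & `|iter n (boole lam d) x| <= M.
Proof.
move=> /existsNP[M HM]; exists M => N; apply: contrapT => H.
apply: HM; exists N => n Nn; rewrite ltNge; apply/negP => nM.
by apply: H; exists n.
Qed.

Section expanding.
Variables (R : realType) (lam d : R).
Hypothesis lam1 : 1 <= lam.
Local Notation f := (boole lam d).
Let lam0 : 0 < lam. Proof. exact: lt_le_trans lam1. Qed.

Lemma boole_expand a b : misses_pole lam d a b ->
  (b - a) * (1 + (a * b)^-1) <= f b - f a.
Proof.
move=> m; have ab0 := misses_pole_sign m; case: m => ab _.
have a0 : a != 0 by apply: contraTneq ab0 => ->; rewrite mul0r ltxx.
have b0 : b != 0 by apply: contraTneq ab0 => ->; rewrite mulr0 ltxx.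
rewrite booleB// -mulrA ler_peMl// mulr_ge0 ?subr_ge0 1?ltW//.
by rewrite addr_gt0// invr_gt0.
Qed.

Lemma length_ndecr a b n k : misses_pole lam d a b ->
  iter n f b - iter n f a <= iter (k + n) f b - iter (k + n) f a.
Proof.
move=> m; elim: k => // k /le_trans; apply.
have mk := misses_pole_iter (k + n) lam0 m.
apply: le_trans (boole_expand mk); rewrite ler_peMr ?subr_ge0 ?(ltW mk.1)//.
by rewrite lerDl invr_ge0 ltW ?(misses_pole_sign mk).
Qed.

(** The gain in length at a return of an endpoint to [-M, M]. The factor of
    expansion tends to 1 when the interval gets long, but the absolute gain does
    not drop below its value for the initial length l0. *)
Lemma length_visit (a b M l0 : R) : misses_pole lam d a b ->
  0 < M -> 0 < l0 -> l0 <= b - a -> (`|a| <= M \/ `|b| <= M) ->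
  b - a + l0 / (M * (M + l0)) <= f b - f a.
Proof.
move=> m M0 l00 lab vis; apply: le_trans (boole_expand m).
have ab0 := misses_pole_sign m; have [ab _] := m.
rewrite [leRHS]mulrDr mulr1 lerD2l.
have Mab : a * b <= M * (M + (b - a)).
  rewrite -(gtr0_norm ab0) normrM.
  have ab1 : `|b| <= `|a| + (b - a).
    rewrite -[X in `|X| <= _](subrK a) addrC (le_trans (ler_normD _ _))//.
    by rewrite lerD2l ger0_norm// subr_ge0 ltW.
  have ab2 : `|a| <= `|b| + (b - a).
    rewrite -[X in `|X| <= _](subrK b) addrC (le_trans (ler_normD _ _))//.
    by rewrite lerD2l -opprB normrN ger0_norm// subr_ge0 ltW.
  case: vis => vis; last rewrite mulrC.
    by rewrite ler_pM// (le_trans ab1)// lerD2r.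
  by rewrite ler_pM// (le_trans ab2)// lerD2r.
rewrite (@le_trans _ _ ((b - a) / (M * (M + (b - a)))))//; last first.
  by rewrite ler_pM2l ?subr_gt0// lef_pV2 ?posrE// mulr_gt0//; lra.
rewrite ler_pdivrMr ?mulr_gt0//; last by lra.
rewrite mulrAC ler_pdivlMr ?mulr_gt0//; last by lra.
rewrite [_ * (M * (M + l0))]mulrCA [l0 * _]mulrCA ler_pM2l//; nra.
Qed.

(** An endpoint whose orbit does not tend to infinity returns infinitely often to
    some [-M, M]; each return adds at least eta to the length, and the length
    never decreases in between. *)
Lemma length_unbounded a b L : misses_pole lam d a b ->
  ~ orbit_unbounded lam d a \/ ~ orbit_unbounded lam d b ->
  exists N, forall n, (N <= n)%N -> L <= iter n f b - iter n f a.
Proof.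
move=> m vis.
have [M M0 {}vis] : exists2 M, 0 < M & forall N, exists2 n, (N <= n)%N &
    `|iter n f a| <= M \/ `|iter n f b| <= M.
  have aux x : ~ orbit_unbounded lam d x -> exists2 M, 0 < M &
      forall N, exists2 n, (N <= n)%N & `|iter n f x| <= M.
    move=> /orbit_recurs[M HM]; exists (Num.max M 1).
      by rewrite lt_max ltr01 orbT.
    by move=> N; have [n Nn nM] := HM N; exists n => //; rewrite le_max nM.
  by case: vis => /aux[M M0 HM]; exists M => // N; have [n Nn nM] := HM N;
    exists n => //; [left|right].
pose l0 := b - a; have l00 : 0 < l0 by rewrite subr_gt0 m.1.
pose eta := l0 / (M * (M + l0)).
have eta0 : 0 < eta by rewrite divr_gt0// mulr_gt0// addr_gt0.
have grow k : exists n, l0 + eta *+ k <= iter n f b - iter n f a.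
  elim: k => [|k [n IH]]; first by exists 0%N; rewrite mulr0n addr0.
  have [p np vp] := vis n; exists p.+1; rewrite mulrSr addrA /=.
  have nd q r : (q <= r)%N ->
      iter q f b - iter q f a <= iter r f b - iter r f a.
    by move=> /subnK <-; exact: length_ndecr.
  apply: le_trans (length_visit _ M0 l00 _ vp); last first.
  - exact: (nd 0%N).
  - exact: misses_pole_iter.
  - by rewrite lerD2r (le_trans IH)// nd.
have [k Hk] : exists k : nat, L <= eta *+ k.
  exists (Num.bound `|L / eta|); rewrite -mulr_natr mulrC -ler_pdivrMr//.
  by rewrite ltW// (le_lt_trans (ler_norm _))// archi_boundP.
have [N HN] := grow k; exists N => n /subnK <-.
apply: le_trans (length_ndecr _ _ m); apply: le_trans HN.
by rewrite (le_trans Hk)// lerDr ltW.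
Qed.

(** If the orbit of the midpoint keeps returning to a bounded region, both halves
    of the interval become longer than that region is wide; at the next return
    of the midpoint one of them contains 0. *)
Lemma expanding_dense a b : a < b ->
  exists2 x, a < x < b & (exists n, iter n f x = 0) \/ orbit_unbounded lam d x.
Proof.
move=> ab; apply: contrapT => H.
(* Shrink so that the closed subinterval stays inside the open one. *)
pose a' := (3 * a + b) / 4; pose b' := (a + 3 * b) / 4; pose c := (a + b) / 2.
have m x y : a' <= x -> x < y -> y <= b' -> misses_pole lam d x y.
  move=> ax xy yb; split=> // z n /andP[xz zy]; apply/eqP => z0.
  apply: H; exists z; last by left; exists n.
  by move: ax yb; rewrite /a' /b' => ax yb; apply/andP; split; lra.
have cb : ~ orbit_unbounded lam d c.
  by move=> cu; apply: H; exists c; [rewrite /c; apply/andP; split; lra|right].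
have m1 : misses_pole lam d a' c by apply: m; rewrite /a' /b' /c; lra.
have m2 : misses_pole lam d c b' by apply: m; rewrite /a' /b' /c; lra.
have [M HM] := orbit_recurs cb.
have [N1 H1] := length_unbounded (`|M| + 1) m1 (or_intror cb).
have [N2 H2] := length_unbounded (`|M| + 1) m2 (or_introl cb).
have [n Nn nM] := HM (maxn N1 N2).
have := H1 n (leq_trans (leq_maxl _ _) Nn).
have := H2 n (leq_trans (leq_maxr _ _) Nn).
have := misses_pole_sign (misses_pole_iter n lam0 m1).
have := misses_pole_sign (misses_pole_iter n lam0 m2).
have := le_trans nM (ler_norm M); rewrite ler_norml => /andP[].
set A := iter n f a'; set B := iter n f b'; set C := iter n f c.
have := normr_ge0 M; have := ler_norm M.
by case: (ltgtP C 0) => [C0|C0|->]; nra.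
Qed.

End expanding.

(** Here infinity is a fixed point of multiplicity three that repels on the real
    line from both sides. *)
Lemma triple_bounded (R : realType) (x : R) :
  (forall n, iter n (boole 1 0) x != 0) -> ~ orbit_unbounded 1 0 x.
Proof.
move=> nz un; have [N HN] := un 1.
have step n : (N <= n)%N ->
    `|iter n.+1 (boole 1 0) x| <= `|iter n (boole 1 0) x|.
  move=> /HN; rewrite iterS; move: (iter n _ x) (nz n) => y y0 y1.
  rewrite /boole mul1r addr0.
  have -> : y - y^-1 = y * (1 - (y ^+ 2)^-1) by field.
  rewrite normrM ler_piMr// ger0_norm ?lerBlDl ?lerDr ?invr_ge0 ?sqr_ge0//.
  rewrite subr_ge0 invf_le1 ?exprn_even_gt0//.
  by rewrite -real_normK ?num_real// exprn_ege1// ltW.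
have bnd k : `|iter (k + N) (boole 1 0) x| <= `|iter N (boole 1 0) x|.
  by elim: k => // k; apply: le_trans; apply: step; rewrite leq_addl.
have [P HP] := un `|iter N (boole 1 0) x|.
by have := bnd P; rewrite leNgt HP// leq_addr.
Qed.

(** * The case of an interior fixed point: expansion of harmonic measure *)

Lemma is_derive_affine (R : realType) (k m x : R) :
  is_derive x 1 (fun x => k * x + m) k.
Proof.
have -> : (fun x => k * x + m) = (k \*: id + cst m) :> (R -> R) by apply/funext.
by apply: is_derive_eq; rewrite addr0 scaler1.
Qed.

Lemma is_derive_boole (R : realType) (lam d x : R) : x != 0 ->
  is_derive x 1 (boole lam d) (lam * (1 + (x ^+ 2)^-1)).
Proof.
move=> x0.
have -> : boole lam d = (lam \*: (id - (fun y => y^-1)) + cst d) :> (R -> R).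
  by apply/funext.
have ? : is_derive x 1 (fun y : R => y^-1) (- x ^- 2).
  by apply: is_derive_eq (is_deriveV _ _) _ => //; rewrite scaler1.
by apply: is_derive_eq; rewrite addr0 opprK.
Qed.

Section elliptic.
Variables (R : realType) (lam d : R).
Hypotheses (lam0 : 0 < lam) (lam1 : lam < 1).
Hypothesis disc : d ^+ 2 < 4 * (lam * (1 - lam)).
Local Notation f := (boole lam d).

(* The fixed points of f are the roots of q. They are complex conjugate. Seen from
   the one in the upper half-plane, the harmonic measure of the real line has
   density proportional to 1/q, and ang is a primitive of e/q. *)
Let eps := lam * (1 - lam) - d ^+ 2 / 4.
Let eps0 : 0 < eps. Proof. by rewrite subr_gt0 ltr_pdivrMr// mulrC. Qed.
Let e := Num.sqrt eps.
Let e0 : 0 < e. Proof. by rewrite sqrtr_gt0. Qed.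
Let e2 : e ^+ 2 = eps. Proof. by rewrite sqr_sqrtr// ltW. Qed.

Let q x := (1 - lam) * x ^+ 2 - d * x + lam.
Let N x := lam * x ^+ 2 + d * x + (1 - lam).

Let q_gt0 x : 0 < q x.
Proof.
suff : 0 < (1 - lam) * q x by rewrite pmulr_rgt0// subr_gt0.
have -> : (1 - lam) * q x = ((1 - lam) * x - d / 2) ^+ 2 + eps.
  by rewrite /q /eps; field.
by rewrite ltr_wpDl// sqr_ge0.
Qed.

Let N_gt0 x : 0 < N x.
Proof.
suff : 0 < lam * N x by rewrite pmulr_rgt0.
have -> : lam * N x = (lam * x + d / 2) ^+ 2 + eps by rewrite /N /eps; field.
by rewrite ltr_wpDl// sqr_ge0.
Qed.

(* The quadratic form N has trace 1 and determinant eps, so its eigenvalues are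
   at most 1 - eps. *)
Let N_le x : N x <= (1 - eps) * (x ^+ 2 + 1).
Proof.
have e1 : 0 < 1 - lam - eps.
  have -> : 1 - lam - eps = (1 - lam) ^+ 2 + (d / 2) ^+ 2.
    by rewrite /eps; field.
  by rewrite ltr_pwDl ?sqr_ge0// exprn_gt0// subr_gt0.
rewrite -subr_ge0 -(pmulr_rge0 _ e1).
have -> : (1 - lam - eps) * ((1 - eps) * (x ^+ 2 + 1) - N x) =
  ((1 - lam - eps) * x - d / 2) ^+ 2 + eps ^+ 2 by rewrite /N /eps; field.
by rewrite addr_ge0// sqr_ge0.
Qed.

Let eps1 : 0 < 1 - eps.
Proof.
have := lt_le_trans (N_gt0 0) (N_le 0).
by rewrite expr0n add0r mulr1.
Qed.

Let ang x := atan ((1 - lam) / e * x + - (d / (2 * e))).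

Let is_derive_ang (x : R) : is_derive x 1 ang (e / q x).
Proof.
have H := is_derive_affine ((1 - lam) / e) (- (d / (2 * e))) x.
apply: is_derive_eq (is_derive1_comp (is_derive1_atan _) H) _.
have -> : q x = (((1 - lam) * x - d / 2) ^+ 2 + e ^+ 2) / (1 - lam).
  by rewrite e2 /q /eps; field; rewrite subr_eq0 gt_eqF.
have D0 : ((1 - lam) * x - d / 2) ^+ 2 + e ^+ 2 != 0.
  by rewrite lt0r_neq0// ltr_wpDl ?sqr_ge0// exprn_gt0.
have -> : 1 + ((1 - lam) / e * x - d / (2 * e)) ^+ 2 =
   (((1 - lam) * x - d / 2) ^+ 2 + e ^+ 2) / e ^+ 2.
  by field; rewrite lt0r_neq0.
move: D0; set D := _ + _ => D0.
by field; rewrite D0 !lt0r_neq0 ?subr_gt0.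
Qed.

Let is_derive_ang_boole (x : R) : x != 0 ->
  is_derive x 1 (ang \o f) (e / q x * ((x ^+ 2 + 1) / N x)).
Proof.
move=> x0.
apply: is_derive_eq
  (is_derive1_comp (is_derive_ang (f x)) (is_derive_boole lam d x0)) _.
have -> : q (f x) = lam * q x * N x / x ^+ 2 by rewrite /q /N /boole; field.
by field; rewrite x0 !lt0r_neq0.
Qed.

Let ang_expand a b : misses_pole lam d a b ->
  (1 - eps) ^-1 * (ang b - ang a) <= ang (f b) - ang (f a).
Proof.
move=> m; have [ab nz] := m.
have xn0 x : x \in `[a, b]%R -> x != 0 by move=> /(nz x 0%N).
pose g := (ang \o f) - ((1 - eps)^-1 \*: ang).
pose g' x := e / q x * ((x ^+ 2 + 1) / N x) - (1 - eps) ^-1 * (e / q x).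
have dg (x : R) : x != 0 -> is_derive x 1 g (g' x).
  move=> x0; have ? := is_derive_ang_boole x0; have ? := is_derive_ang x.
  exact: is_deriveB.
have [||c cab gE] := @MVT R g g' a b ab.
- by move=> x xab; apply/dg/xn0; exact: subset_itv_oo_cc.
- apply: derivable_within_continuous => x xab.
  by have ? := dg x (xn0 _ xab); exact: ex_derive.
rewrite -subr_ge0.
have -> : ang (f b) - ang (f a) - (1 - eps)^-1 * (ang b - ang a) = g b - g a.
  by rewrite /g !fctE /= /GRing.scale /=; ring.
rewrite gE mulr_ge0 ?subr_ge0 ?(ltW ab)// mulrC ler_pM2l ?divr_gt0//.
rewrite ler_pdivlMr// -(ler_pM2l eps1) mulrA mulfV ?gt_eqF// mul1r.
exact: N_le.
Qed.

(** The measure ang b - ang a of an interval never exceeds pi, whereas it is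
    multiplied by at least 1 / (1 - eps) by every step that misses the pole. *)
Lemma elliptic_hits_pole a b : ~ misses_pole lam d a b.
Proof.
move=> m.
have k1 : 0 < (1 - eps)^-1 - 1.
  by rewrite subr_gt0 invf_gt1// gtrBl.
have grow n : (1 + ((1 - eps)^-1 - 1) *+ n) * (ang b - ang a) <=
    ang (iter n f b) - ang (iter n f a).
  elim: n => [|n IH]; first by rewrite mulr0n addr0 mul1r.
  have mn := misses_pole_iter n lam0 m.
  rewrite !iterS; apply: le_trans (ang_expand mn).
  have ang0 : 0 <= ang b - ang a.
    rewrite subr_ge0 le_atan// lerD2r ler_pM2l ?(ltW m.1)//.
    by rewrite divr_gt0// subr_gt0.
  have D0 : ang b - ang a <= ang (iter n f b) - ang (iter n f a).
    by apply: le_trans IH; rewrite ler_peMl// lerDl mulrn_wge0// ltW.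
  by rewrite mulrS; nra.
have ang_gt0 : 0 < ang b - ang a.
  rewrite subr_gt0 lt_atan// ltrD2r ltr_pM2l ?m.1//.
  by rewrite divr_gt0// subr_gt0.
have [n Hn] : exists n : nat, pi < ((1 - eps)^-1 - 1) *+ n * (ang b - ang a).
  have c0 : 0 < ((1 - eps)^-1 - 1) * (ang b - ang a) by exact: mulr_gt0.
  exists (Num.bound (pi / (((1 - eps)^-1 - 1) * (ang b - ang a)))).
  rewrite -mulr_natl -mulrA -ltr_pdivrMr//.
  by rewrite archi_boundP// divr_ge0 ?pi_ge0// ltW.
have := grow n; rewrite mulrDl mul1r.
have : ang (iter n f b) < pi / 2 by exact: atan_ltpi2.
have : - (pi / 2) < ang (iter n f a) by exact: atan_gtNpi2.
by move: Hn ang_gt0; lra.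
Qed.

Lemma elliptic_dense a b : a < b ->
  exists2 x, a < x < b & exists n, iter n f x = 0.
Proof.
move=> ab; apply: contrapT => H.
apply: (@elliptic_hits_pole ((3 * a + b) / 4) ((a + 3 * b) / 4)).
split=> [|x n /andP[ax xb]]; first by lra.
by apply/eqP => x0; apply: H; exists x; [apply/andP; split; lra|exists n].
Qed.

End elliptic.

(** * Arguments, rays and the exponential e^{it} *)

Section complex_plane.
Local Open Scope complex_scope.
Local Open Scope quotient_scope.

Ltac by_coordinates :=
  apply/eqP; rewrite eq_complex /=; apply/andP; split; apply/eqP.

Lemma expiD (R : realType) (s t : R) : expi (s + t) = expi s * expi t.
Proof. by rewrite /expi sinD cosD; by_coordinates; ring. Qed.

Lemma expi_pi (R : realType) : expi (pi : R) = -1.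
Proof. by rewrite /expi cospi sinpi; by_coordinates; rewrite ?oppr0. Qed.

Lemma expi0 (R : realType) : expi (0 : R) = 1.
Proof. by rewrite /expi cos0 sin0. Qed.

Lemma expi_conj (R : realType) (t : R) : expi t * conjc (expi t) = 1.
Proof. by rewrite /expi; by_coordinates; [rewrite -(cos2Dsin2 t)|]; ring. Qed.

Lemma expi_neq0 (R : realType) (t : R) : expi t != 0.
Proof.
apply: contraTneq (oner_neq0 R[i]) => t0.
by rewrite -(expi_conj t) t0 mul0r eqxx.
Qed.

Lemma norm_expi (R : realType) (r t : R) : 0 <= r -> `|r%:C * expi t| = r%:C.
Proof.
move=> r0; rewrite normrM !normc_def /= cos2Dsin2 sqrtr1 mulr1.
by rewrite expr0n /= addr0 sqrtr_sqr ger0_norm.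
Qed.

Lemma expi_int (R : realType) (k : int) : expi (k%:~R * (2 * pi) : R) = 1.
Proof.
have expi_nat (n : nat) : expi (n%:R * (2 * pi) : R) = 1.
  elim: n => [|n IH]; first by rewrite mul0r expi0.
  rewrite -natr1 mulrDl expiD IH !mul1r mulr_natl mulr2n expiD expi_pi.
  by rewrite mulrNN mulr1.
case: k => n; first exact: expi_nat.
rewrite NegzE mulrNz mulNr; set x := _ * _.
have : expi (x + - x) = 1 by rewrite subrr expi0.
by rewrite expiD expi_nat mul1r.
Qed.

(** After reduction of t to [0, 2 pi), injectivity of cos on [0, pi] applies to t
    or to 2 pi - t. *)
Lemma cos_eq1 (R : realType) (t : R) : cos t = 1 ->
  exists k : int, t = k%:~R * (2 * pi).
Proof.
move=> t1; have pi0 := pi_gt0 R; have p20 : 0 < 2 * pi :> R by rewrite mulr_gt0.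
pose k := Num.floor (t / (2 * pi)); exists k.
pose x := t - k%:~R * (2 * pi).
have cosx : cos x = 1.
  have : expi t = expi x.
    by rewrite -[in LHS](subrK (k%:~R * (2 * pi)) t) expiD expi_int mulr1.
  by rewrite /expi t1 => -[].
have [x0 x2] : 0 <= x /\ x < 2 * pi.
  have := floor_itv (t / (2 * pi)); rewrite -/k => /andP[].
  by rewrite ler_pdivlMr// ltr_pdivrMr// intrD mulrDl mul1r /x; lra.
suff : x = 0 by move/eqP; rewrite subr_eq0 => /eqP.
have [xpi|xpi] := leP x pi.
  by apply: cos_inj; rewrite ?in_itv/= ?lexx ?x0 ?pi_ge0 ?cos0.
have : 2 * pi - x = 0; last by lra.
apply: cos_inj; rewrite ?in_itv/= ?lexx ?pi_ge0//.
  by apply/andP; split; lra.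
by rewrite cos0 addrC mulr_natl cosD2pi cosN.
Qed.

Lemma angleP (R : realType) (s t : R) : angle s = angle t <-> expi s = expi t.
Proof.
split.
  move=> /eqquotP /asboolP[k st].
  by rewrite -(subrK t s) st expiD expi_int mul1r.
move=> st; apply/eqquotP/asboolP; apply: cos_eq1.
have := expi_conj t; rewrite -{1}st => /eqP.
rewrite eq_complex /= => /andP[/eqP + _].
by rewrite mulrN opprK -cosB.
Qed.

Lemma reprE (R : realType) (t : R) : expi (repr (angle t)) = expi t.
Proof. by apply/angleP; exact: reprK. Qed.

Lemma circle_angle (R : realType) (phi : circle R) : phi = angle (repr phi).
Proof. by rewrite /angle reprK. Qed.

Lemma expi_atan (R : realType) (y : R) :
  1 +i* y = (Num.sqrt (1 + y ^+ 2))%:C * expi (atan y).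
Proof.
have s0 : Num.sqrt (1 + y ^+ 2) != 0.
  by rewrite lt0r_neq0// sqrtr_gt0 ltr_pwDl// sqr_ge0.
have c0 : cos (atan y) != 0 by rewrite cos_atan invr_eq0.
have sE : sin (atan y) = y * cos (atan y) by rewrite -{2}[y]atanK /tan mulfVK.
by rewrite /expi sE cos_atan; by_coordinates; field.
Qed.

Lemma expi_chart (R : realType) (y : R) :
  (y -i* 1) ^+ 2 = (1 + y ^+ 2)%:C * expi (pi + 2 * atan y).
Proof.
have r0 : 0 <= 1 + y ^+ 2 by rewrite addr_ge0// sqr_ge0.
have -> : (y -i* 1) ^+ 2 = - (1 +i* y) ^+ 2 by rewrite !expr2; by_coordinates; ring.
rewrite expi_atan exprMn -rmorphXn /= sqr_sqrtr// expiD expi_pi mulN1r mulrN.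
by rewrite mulr_natl mulr2n expiD expr2.
Qed.

(** y - i is the square root of z in the lower half-plane, scaled to imaginary
    part -1; only nonnegative real z lack such a square root. *)
Lemma square_chart (R : realType) (z : R[i]) : complex.Im z != 0 ->
  exists2 r : R, 0 < r & exists y, z = r%:C * (y -i* 1) ^+ 2.
Proof.
case: z => a b /= b0; pose rho := Num.sqrt (a ^+ 2 + b ^+ 2).
have rho2 : rho ^+ 2 = a ^+ 2 + b ^+ 2 by rewrite sqr_sqrtr// addr_ge0 ?sqr_ge0.
have b2 : 0 < b ^+ 2 by rewrite exprn_even_gt0.
have arho : a < rho.
  rewrite ltNge; apply/negP => rhoa.
  by have : 0 <= rho by [exact: sqrtr_ge0]; nra.
exists ((rho - a) / 2); first by lra.
exists (- b / (rho - a)); rewrite expr2; by_coordinates.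
  apply/eqP; rewrite -subr_eq0.
  have -> : a - ((rho - a) / 2 * (- b / (rho - a) * (- b / (rho - a)) - - 1 * - 1)
     - 0 * (- b / (rho - a) * - 1 + - 1 * (- b / (rho - a)))) =
     (rho ^+ 2 - a ^+ 2 - b ^+ 2) / (2 * (rho - a)).
    by field; rewrite subr_eq0 gt_eqF.
  by rewrite rho2 addrAC addrK subrr mul0r.
by field; rewrite subr_eq0 gt_eqF.
Qed.

Lemma polar (R : realType) (z : R[i]) : z != 0 ->
  exists2 r : R, 0 < r & exists t, z = r%:C * expi t.
Proof.
have [b0|/square_chart[r r0 [y ->]] _] := eqVneq (complex.Im z) 0; last first.
  exists (r * (1 + y ^+ 2)); first by rewrite mulr_gt0// ltr_pwDl// sqr_ge0.
  by exists (pi + 2 * atan y); rewrite expi_chart mulrA -rmorphM.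
case: z b0 => a b /= ->; rewrite eq_complex /= eqxx andbT => a0.
have [a1|a1] : a < 0 \/ 0 < a by apply/orP; rewrite -neq_lt.
  exists (- a); first by lra.
  by exists pi; rewrite expi_pi; by_coordinates; ring.
by exists a => //; exists 0; rewrite expi0 mulr1.
Qed.

Lemma argE (R : realType) (r t : R) : 0 < r -> arg (r%:C * expi t) = angle t.
Proof.
move=> r0; apply/angleP; rewrite norm_expi ?ltW//.
case: xgetP => [s _ /= /esym|/(_ t)/(_ erefl)//].
by apply: mulfI; rewrite eq_complex /= eqxx andbT lt0r_neq0.
Qed.

Lemma rayP (R : realType) (t : R) (z : R[i]) :
  ray (angle t) z <-> exists2 r : R, 0 <= r & z = r%:C * expi t.
Proof. by rewrite /ray /= reprE. Qed.

Lemma ray_inj (R : realType) : injective (@ray R).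
Proof.
move=> phi psi; rewrite (circle_angle phi) (circle_angle psi).
move: (repr phi) (repr psi) => s t /seteqP[st _].
have [|r r0 E] := (rayP t _).1 (st (expi s) _).
  by apply/rayP; exists 1; rewrite ?mul1r.
have := norm_expi t r0; rewrite -E -[expi s]mul1r norm_expi// => r1.
by apply/angleP; rewrite E -r1 mul1r.
Qed.

(** * The linear map h in a rotated frame *)

Section squared_map.
Variables (R : realType) (K theta : R).
Hypothesis K1 : 1 < K.
Local Notation H := (Hmap K theta).
Local Notation h := (hmap K theta).
Local Notation Ht := (Htilde K theta).
Let K0 : 0 < K. Proof. exact: lt_trans K1. Qed.

Lemma hmap_scale (r : R) z : h (r%:C * z) = r%:C * h z.
Proof. by rewrite /hmap; case: z => a b; rewrite /expi; by_coordinates; ring. Qed.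

Lemma Hmap_scale (r : R) z : H (r%:C * z) = (r ^+ 2)%:C * H z.
Proof. by rewrite /Hmap hmap_scale exprMn rmorphXn. Qed.

(** In the coordinate centred at a fixed direction t, Htilde is the map
    boole (stretch t) (drift t). The number stretch t is |h(e^{it})|^2 / (2K), as
    hmap_normsq shows, and its inverse is the derivative of Htilde at t. *)
Definition stretch (t : R) :=
  (K ^+ 2 + 1 + (K ^+ 2 - 1) * cos (2 * theta - 2 * t)) / (4 * K).
Definition drift (t : R) := (1 - K ^+ 2) / (2 * K) * sin (2 * theta - 2 * t).

Lemma stretch_gt0 t : 0 < stretch t.
Proof.
rewrite divr_gt0//; last by rewrite mulr_gt0.
have K2 : 0 <= K ^+ 2 - 1 by rewrite subr_ge0 exprn_ege1// ltW.
have c1 : 0 <= cos (2 * theta - 2 * t) + 1.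
  by have := cos_geN1 (2 * theta - 2 * t); lra.
by have := mulr_ge0 K2 c1; rewrite mulrDr mulr1; lra.
Qed.

(** The real-linear map z |-> h(e^{it} z) / h(e^{it}). It fixes 1, and i goes to
    the quotient of h(i e^{it}) by h(e^{it}). *)
Definition shear t (z : R[i]) : R[i] :=
  (complex.Re z - drift t / (2 * stretch t) * complex.Im z) +i*
  (complex.Im z / (2 * stretch t)).

(** Conjugating by the rotation of angle t replaces theta by theta - t. *)
Lemma hmap_mul t z : h (expi t * z) = expi t *
  (((K + 1) / 2)%:C * z +
   ((K - 1) / 2)%:C * expi (2 * theta - 2 * t) * conjc z).
Proof.
have -> : expi (2 * theta - 2 * t) =
    expi (2 * theta) * (conjc (expi t) * conjc (expi t)).
  have -> : conjc (expi t) = expi (- t) by rewrite /expi sinN cosN.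
  by rewrite -!expiD; congr expi; ring.
have -> : h (expi t * z) = ((K + 1) / 2)%:C * (expi t * z) +
    expi (2 * theta) * ((K - 1) / 2)%:C * conjc (expi t * z) by [].
have -> : conjc (expi t * z) = conjc (expi t) * conjc z by exact: rmorphM.
rewrite -[conjc (expi t) * conjc z]mul1r -(expi_conj t).
move: (expi _) (expi _) (conjc (expi t)) (conjc z) (_%:C) (_%:C) => e u v w p m.
by ring.
Qed.

Lemma stretchE t : 4 * K * stretch t =
  K ^+ 2 + 1 + (K ^+ 2 - 1) * cos (2 * theta - 2 * t).
Proof. by rewrite /stretch mulrC mulfVK// mulf_neq0// gt_eqF. Qed.

Lemma hmap_shear t z : h (expi t * z) = h (expi t) * shear t z.
Proof.
rewrite -[expi t in RHS]mulr1 !hmap_mul -[RHS]mulrA; congr (expi t * _).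
have l0 := stretch_gt0 t; rewrite /shear /drift.
have := stretchE t; have := cos2Dsin2 (2 * theta - 2 * t).
rewrite /expi; case: z => a b /=; set X := cos _; set Y := sin _.
move: (stretch t) l0 => l l0 XY lE.
have Y2 : Y ^+ 2 = 1 - X ^+ 2 by rewrite -XY addrC addKr.
have Kn0 : K != 0 by rewrite gt_eqF.
have ln0 : 4 * K * l != 0 by rewrite !mulf_neq0// gt_eqF.
have -> : l = (4 * K * l) / (4 * K) by field.
rewrite lE in ln0 *.
by_coordinates.
  by field; apply/andP; split.
apply/eqP; rewrite -subr_eq0; apply/eqP.
transitivity ((K ^+ 2 - 1) * (K - 1) / (2 * (K ^+ 2 + 1 + (K ^+ 2 - 1) * X)) *
  b * (1 - X ^+ 2 - Y ^+ 2)); last by rewrite Y2 subrr mulr0.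
by field; apply/andP; split.
Qed.

Lemma hmap_normsq t : h (expi t) * conjc (h (expi t)) = (2 * K * stretch t)%:C.
Proof.
rewrite -[expi t]mulr1 hmap_mul.
have -> : conjc (expi t * (((K + 1) / 2)%:C * 1 +
    ((K - 1) / 2)%:C * expi (2 * theta - 2 * t) * conjc 1)) =
  conjc (expi t) * conjc (((K + 1) / 2)%:C * 1 +
    ((K - 1) / 2)%:C * expi (2 * theta - 2 * t) * conjc 1) by exact: rmorphM.
rewrite mulrACA expi_conj mul1r.
have := stretchE t; have := cos2Dsin2 (2 * theta - 2 * t).
rewrite /expi; set X := cos _; set Y := sin _ => XY lE.
have Y2 : Y ^+ 2 = 1 - X ^+ 2 by rewrite -XY addrC addKr.
by_coordinates; last by ring.
have -> : 2 * K * stretch t = (4 * K * stretch t) / 2 by field.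
rewrite lE.
apply/eqP; rewrite -subr_eq0; apply/eqP.
transitivity (((K - 1) / 2) ^+ 2 * (Y ^+ 2 - (1 - X ^+ 2))); last first.
  by rewrite Y2 subrr mulr0.
by field.
Qed.

End squared_map.

Lemma expi_scale_inj (R : realType) (q r s t : R) : 0 < q -> 0 < r ->
  q%:C * expi s = r%:C * expi t -> expi s = expi t.
Proof.
move=> q0 r0 E; have := congr1 Num.norm E.
rewrite !norm_expi ?ltW// => qr; move: E; rewrite qr; apply: mulfI.
by rewrite eq_complex /= eqxx andbT lt0r_neq0.
Qed.

(** * The coordinate centred at a fixed direction *)

(** The direction of e^{it} (y - i)^2, see chartE. The missing direction t is the
    point at infinity. *)
Definition chart {R : realType} (t y : R) : circle R :=
  angle (t + pi + 2 * atan y).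

Lemma chartE (R : realType) (t y : R) :
  expi t * (y -i* 1) ^+ 2 = (1 + y ^+ 2)%:C * expi (t + pi + 2 * atan y).
Proof. by rewrite expi_chart -(addrA t) (expiD t) mulrCA. Qed.

Lemma chart_inj (R : realType) (t : R) : injective (chart t).
Proof.
move=> x y /angleP E.
have : (1 + y ^+ 2)%:C * (x -i* 1) ^+ 2 = (1 + x ^+ 2)%:C * (y -i* 1) ^+ 2.
  apply: (mulfI (expi_neq0 t)); rewrite [LHS]mulrCA [RHS]mulrCA !chartE E.
  by rewrite mulrCA.
move/eqP; rewrite !expr2 eq_complex /= => /andP[/eqP E1 /eqP E2].
have xy : x ^+ 2 = y ^+ 2 by lra.
have y0 : 1 + y ^+ 2 != 0 by rewrite lt0r_neq0// ltr_pwDl// sqr_ge0.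
apply: (mulfI y0); rewrite -{2}xy; lra.
Qed.

Lemma chart_neq (R : realType) (t y : R) : chart t y <> angle t.
Proof.
move=> /angleP E.
have : (y -i* 1) ^+ 2 = (1 + y ^+ 2)%:C.
  apply: (mulfI (expi_neq0 t)); rewrite chartE E mulrC //.
move/eqP; rewrite expr2 eq_complex /= => /andP[/eqP + _]; lra.
Qed.

(** Directions off the real line of the rotated frame come from a square root;
    the one opposite to t is y = 0. *)
Lemma chart_surj (R : realType) (t : R) (phi : circle R) : phi != angle t ->
  exists y, phi = chart t y.
Proof.
rewrite (circle_angle phi); move: (repr phi) => s /eqP st.
have sE : expi s = expi t * expi (s - t) by rewrite -expiD addrC subrK.
have [b0|/square_chart[r r0 [y yE]]] := eqVneq (complex.Im (expi (s - t))) 0.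
  exists 0; apply/angleP.
  rewrite atan0 mulr0 addr0 expiD expi_pi sE; congr (_ * _).
  have c2 := cos2Dsin2 (s - t); rewrite /= in b0; rewrite b0 expr0n addr0 in c2.
  have /eqP := c2; rewrite sqrf_eq1 => /orP[] /eqP c1.
    by exfalso; apply/st/angleP; rewrite sE /expi b0 c1 mulr1.
  by rewrite /expi b0 c1; by_coordinates; rewrite ?oppr0.
exists y; apply/angleP; rewrite sE yE.
rewrite -(addrA t) (expiD t) -yE; congr (_ * _).
have E : 1%:C * expi (s - t) = (r * (1 + y ^+ 2))%:C * expi (pi + 2 * atan y).
  by rewrite mul1r yE expi_chart mulrA rmorphM.
by apply: expi_scale_inj E; rewrite ?mulr_gt0// ltr_pwDl// sqr_ge0.
Qed.

Section fixed_direction.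
Variables (R : realType) (K theta : R).
Hypothesis K1 : 1 < K.
Local Notation H := (Hmap K theta).
Local Notation Ht := (Htilde K theta).

Lemma Hmap_expi_neq0 t : H (expi t) != 0.
Proof.
rewrite expf_neq0//; have := hmap_normsq theta K1 t.
apply: contra_eq_neq => ->; rewrite mul0r eq_sym eq_complex /= eqxx andbT.
rewrite lt0r_neq0// mulr_gt0 ?stretch_gt0// mulr_gt0//; exact: lt_trans K1.
Qed.

Lemma HtildeP s s' : Ht (angle s) = angle s' <->
  exists2 r : R, 0 < r & H (expi s) = r%:C * expi s'.
Proof.
rewrite /Htilde reprE; split=> [|[r r0 ->]]; last exact: argE.
have [r r0 [t E]] := polar (Hmap_expi_neq0 s).
by rewrite E argE// => /angleP ->; exists r.
Qed.

Lemma Htilde_scale r s r' s' : 0 < r -> 0 < r' ->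
  H (r%:C * expi s) = r'%:C * expi s' -> Ht (angle s) = angle s'.
Proof.
move=> r0 r0' E; apply/HtildeP; exists (r' / r ^+ 2).
  by rewrite divr_gt0// exprn_gt0.
have r2 : (r ^+ 2)%:C != 0 by rewrite eq_complex /= eqxx andbT expf_neq0// gt_eqF.
apply: (mulfI r2); rewrite -Hmap_scale E mulrA -rmorphM; congr (_ %:C * _) => /=.
by field; rewrite gt_eqF.
Qed.

Variable t : R.
Hypothesis tfix : Ht (angle t) = angle t.
Local Notation lam := (stretch K theta t).
Local Notation d := (drift K theta t).
Local Notation f := (boole lam d).
Let lam0 : 0 < lam. Proof. exact: stretch_gt0. Qed.

Lemma Hmap_fixed : exists2 r : R, 0 < r &
  forall z, H (expi t * z) = r%:C * (expi t * shear K theta t z ^+ 2).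
Proof.
have /HtildeP[r r0 E] := tfix; exists r => // z.
by rewrite /Hmap hmap_shear// exprMn -/(Hmap K theta _) E mulrA.
Qed.

(** This is why the coordinate is a square: the shear sends (y - i)^2 to a real
    multiple of f(y) - i, whose square is again a chart vector. *)
Lemma shear_chart y : y != 0 ->
  shear K theta t ((y -i* 1) ^+ 2) = (y / lam)%:C * (f y -i* 1).
Proof.
move=> y0; rewrite /shear /boole expr2; have ln0 := lt0r_neq0 lam0; by_coordinates.
  by field; apply/andP; split.
by field; apply/andP; split.
Qed.

Lemma Htilde_chart y : y != 0 -> Ht (chart t y) = chart t (f y).
Proof.
move=> y0; have [r r0 HE] := Hmap_fixed.
apply: (@Htilde_scale (1 + y ^+ 2) _ (r * (y / lam) ^+ 2 * (1 + f y ^+ 2))).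
- by rewrite ltr_pwDl// sqr_ge0.
- rewrite mulr_gt0 ?(ltr_pwDl ltr01 (sqr_ge0 _))// pmulr_rgt0//.
  by rewrite exprn_even_gt0//= mulf_neq0// invr_neq0// gt_eqF.
rewrite -chartE HE shear_chart// exprMn -rmorphXn [in RHS]rmorphM -[RHS]mulrA.
by rewrite -chartE [in RHS]rmorphM -[RHS]mulrA; congr (_ * _); rewrite mulrCA.
Qed.

Lemma Htilde_chart0 : Ht (chart t 0) = angle t.
Proof.
have [r r0 HE] := Hmap_fixed.
apply: (@Htilde_scale 1 _ r) => //.
rewrite mul1r /chart atan0 mulr0 addr0 expiD expi_pi HE; congr (_ * _).
have -> : shear K theta t (- 1) = - 1.
  by rewrite /shear; by_coordinates; rewrite ?oppr0 ?mulr0 ?mul0r ?subr0.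
by rewrite sqrrN expr1n mulr1.
Qed.

Lemma fixed_chartP y : Ht (chart t y) = chart t y <-> y != 0 /\ f y = y.
Proof.
have [->|y0] := eqVneq y 0.
  by rewrite Htilde_chart0; split=> [/esym/chart_neq|[]].
by rewrite Htilde_chart//; split=> [/chart_inj|[_ ->]].
Qed.

(** Since y is fixed, shear_chart gives h on the chart vector as h(e^{it}) times a
    real multiple of y - i; compare the squared moduli. *)
Lemma stretch_chart y : y != 0 -> f y = y ->
  stretch K theta (t + pi + 2 * atan y) = y ^+ 2 / (lam * (1 + y ^+ 2)).
Proof.
move=> y0 fy; have K0 : 0 < K by exact: lt_trans K1.
have yy : 0 < 1 + y ^+ 2 by rewrite ltr_pwDl// sqr_ge0.
have hE : (1 + y ^+ 2)%:C * hmap K theta (expi (t + pi + 2 * atan y)) =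
   hmap K theta (expi t) * ((y / lam)%:C * (y -i* 1)).
  have sE := shear_chart y0; rewrite fy in sE.
  rewrite -sE -hmap_shear// chartE hmap_scale //.
have cM (a b : R[i]) : (a * b) * conjc (a * b) = (a * conjc a) * (b * conjc b).
  by rewrite [conjc (_ * _)]rmorphM mulrACA.
have := cM (1 + y ^+ 2)%:C (hmap K theta (expi (t + pi + 2 * atan y))).
rewrite hE !cM !hmap_normsq// => /eqP.
rewrite eq_complex /= => /andP[/eqP E _].
have c0 : (1 + y ^+ 2) ^+ 2 * (2 * K) != 0.
  by rewrite !mulf_neq0 ?expf_neq0// gt_eqF.
apply: (mulfI c0).
transitivity (2 * K * lam * (y / lam) ^+ 2 * (1 + y ^+ 2)).
  by move: E; set u := stretch _ _ _; set v := stretch _ _ _ => E; lra.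
field; rewrite !gt_eqF//.
Qed.

End fixed_direction.

(** * Multipliers of fixed directions *)

(** Two lifts differ near t by multiples of 2 pi, so sin (F - G) vanishes near t;
    its derivative at t is a - b. *)
Lemma circle_lift_derive_unique (R : realType) (phi : circle R -> circle R)
    (F G : R -> R) (t a b : R) :
  (\forall s \near t, phi (angle s) = angle (F s)) ->
  (\forall s \near t, phi (angle s) = angle (G s)) ->
  is_derive t 1 F a -> is_derive t 1 G b -> a = b.
Proof.
move=> nF nG dF dG.
have nE : \forall s \near t, expi (F s) = expi (G s).
  near=> s; apply/angleP.
  by transitivity (phi (angle s)); [apply/esym; near: s|near: s].
have dFG : is_derive t 1 (sin \o (F - G)) (cos (F t - G t) * (a - b)).
  exact: is_derive1_comp.
have FGt : cos (F t - G t) = 1.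
  have := nbhs_singleton nE; rewrite /expi => -[c s].
  by rewrite cosB c s -(cos2Dsin2 (G t)).
have nn : \forall s \near t, (sin \o (F - G)) s = cst 0 s.
  near=> s; have : expi (F s) = expi (G s) by near: s.
  by rewrite /expi /= !fctE sinB => -[-> ->]; rewrite mulrC subrr.
have := near_eq_derive (1 : R) nn; rewrite !derive_val FGt mul1r => /eqP.
by rewrite subr_eq0 => /eqP.
Unshelve. all: by end_near. Qed.

Section lift.
Variables (R : realType) (K theta : R).
Hypothesis K1 : 1 < K.
Local Notation H := (Hmap K theta).
Local Notation Ht := (Htilde K theta).
Local Notation lam := (stretch K theta).
Local Notation d := (drift K theta).

(** In the frame of t, h acts by the shear, so the angle turns by the arctangent
    of the ratio be/al of the coordinates of the sheared vector; squaring doubles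
    it. *)
Lemma local_lift t : Ht (angle t) = angle t ->
  exists2 G : R -> R, \forall s \near t, Ht (angle s) = angle (G s)
    & is_derive t 1 G (lam t)^-1.
Proof.
move=> tfix; have l0 : 0 < lam t by exact: stretch_gt0.
pose k := (2 * lam t)^-1; have k0 : k != 0 by rewrite gt_eqF// invr_gt0 mulr_gt0.
pose sh (s : R) := s - t.
have dsh (s : R) : is_derive s 1 sh 1.
  have -> : sh = id - cst t by apply/funext.
  by apply: is_derive_eq; rewrite subr0.
pose al := (cos \o sh) - (d t * k) \*: (sin \o sh).
pose be := k \*: (sin \o sh).
have dbe : is_derive t 1 be k.
  have ? := is_derive1_comp (is_derive_sin (sh t)) (dsh t).
  by apply: is_derive_eq; rewrite /sh subrr cos0 mulr1 /GRing.scale /= mulr1.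
have dal : is_derive t 1 al (- (d t * k)).
  have ? := is_derive1_comp (is_derive_sin (sh t)) (dsh t).
  have ? := is_derive1_comp (is_derive_cos (sh t)) (dsh t).
  apply: is_derive_eq.
  by rewrite /sh subrr cos0 sin0 !mulr1 /GRing.scale /= mulr1 oppr0 add0r.
have alt : al t = 1.
  by rewrite /al !fctE /= /sh subrr cos0 sin0 scaler0 subr0.
have bet : be t = 0 by rewrite /be !fctE /= /sh subrr sin0 scaler0.
exists (cst t + 2 \*: (atan \o (be * (fun s => (al s)^-1)))).
  have al_gt0 : \forall s \near t, 0 < al s.
    have cal : {for t, continuous al}.
      by apply/differentiable_continuous/derivable1_diffP; exact: ex_derive.
    by apply: (cvgr_gt (al t) cal); rewrite alt.
  have [r r0 HE] := Hmap_fixed K1 tfix.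
  near=> s; have as0 : 0 < al s by near: s.
  set v := be s / al s.
  apply/HtildeP => //; exists (r * (al s * Num.sqrt (1 + v ^+ 2)) ^+ 2).
    by rewrite mulr_gt0// exprn_gt0// mulr_gt0// sqrtr_gt0 ltr_pwDl// sqr_ge0.
  have -> : expi s = expi t * expi (s - t) by rewrite -expiD addrC subrK.
  have shE : shear K theta t (expi (s - t)) =
      (al s * Num.sqrt (1 + v ^+ 2))%:C * expi (atan v).
    rewrite rmorphM -mulrA -expi_atan.
    have -> : shear K theta t (expi (s - t)) = al s +i* be s.
      rewrite /shear /al /be !fctE /= /sh /GRing.scale /= /k.
      by by_coordinates; [rewrite mulrA|rewrite mulrC].
    by rewrite /v; by_coordinates; field; rewrite gt_eqF.
  rewrite HE shE exprMn -rmorphXn [in RHS]rmorphM -[RHS]mulrA; congr (_ * _).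
  rewrite mulrCA; congr (_ * _).
  rewrite [X in _ = expi X](_ : _ = t + (atan v + atan v)); last first.
    by rewrite -[LHS]/(t + 2 * atan v) mulr_natl mulr2n.
  by rewrite !expiD expr2.
have dinv : is_derive t 1 (fun s => (al s)^-1) (d t * k).
  apply: is_derive_eq (is_deriveV _ dal) _; first by rewrite alt oner_neq0.
  by rewrite alt expr1n invr1 scaleNr scale1r opprK.
have dv : is_derive t 1 (be * (fun s => (al s)^-1)) k.
  apply: is_derive_eq.
  by rewrite alt bet invr1 scale0r scale1r add0r.
have ? := is_derive1_comp (is_derive1_atan _) dv.
apply: is_derive_eq.
rewrite !fctE /= bet mul0r expr0n addr0 invr1 mul1r add0r /GRing.scale /= /k.
by field; rewrite gt_eqF.
Unshelve. all: by end_near. Qed.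

Lemma eq_stretch s t : angle s = angle t -> lam s = lam t.
Proof.
move=> /angleP st; have := hmap_normsq theta K1 t.
rewrite -st hmap_normsq// => /eqP; rewrite eq_complex /= => /andP[/eqP + _].
by apply: mulfI; rewrite gt_eqF// mulr_gt0// (lt_trans _ K1).
Qed.

(** The derivative of Htilde at the fixed direction t is 1 / stretch t. *)
Lemma locally_repellingP t : Ht (angle t) = angle t ->
  locally_repelling K theta (angle t) <-> lam t < 1.
Proof.
move=> tfix; have l0 : 0 < lam t by exact: stretch_gt0.
split=> [[a [s [F [ts nF dF]]] a1]|l1].
  have sfix : Ht (angle s) = angle s by rewrite -ts.
  have [G nG dG] := local_lift sfix.
  rewrite (eq_stretch ts).
  move: a1; rewrite (circle_lift_derive_unique nF nG dF dG).
  by rewrite invf_gt1// (stretch_gt0 theta K1).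
have [G nG dG] := local_lift tfix.
exists (lam t)^-1; last by rewrite invf_gt1.
by exists t, G.
Qed.

End lift.

(** * From dense sets of directions to dense sets in the plane *)

(** Reduces the complex-valued metric of the plane to real boxes in the rotated
    frame. *)
Lemma open_rotated_box (R : realType) (O : set R[i]) (t : R) (z : R[i]) :
  open O -> O (expi t * z) -> exists2 e : R, 0 < e &
    forall x y, `|x| + `|y| < e -> O (expi t * (z + (x +i* y))).
Proof.
move=> oO Oz; have /nbhs_ballP[[e e'] /= e0 He] := open_nbhs_nbhs (conj oO Oz).
move: e0; rewrite ltcE /= => /andP[/eqP e'0 e0]; exists e => // x y xy.
apply: He; rewrite /ball /= /ball_ mulrDr opprD addrA subrr sub0r normrN normrM.
have := norm_expi t ler01; rewrite mul1r => ->.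
rewrite mul1r normc_def ltcE /= e'0 eqxx /=.
apply: le_lt_trans xy.
rewrite -(ger0_norm (addr_ge0 (normr_ge0 x) (normr_ge0 y))).
rewrite -sqrtr_sqr ler_wsqrtr//.
have xx : `|x| ^+ 2 = x ^+ 2 by rewrite real_normK ?num_real.
have yy : `|y| ^+ 2 = y ^+ 2 by rewrite real_normK ?num_real.
by have := mulr_ge0 (normr_ge0 x) (normr_ge0 y); lra.
Qed.

(** A vector off the axis of the rotated frame is r e^{it} (y0 - i)^2, and
    r e^{it} (y - i)^2 stays in the open set for y close to y0. *)
Lemma dense_rays (R : realType) (t : R) (S : set (circle R)) :
  (forall a b, a < b -> exists2 y, a < y < b & S (chart t y)) ->
  dense (\bigcup_(phi in S) ray phi).
Proof.
move=> dS O [z0 Oz0] oO.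
have [w [w0 [e e0 He]]] : exists w : R[i], complex.Im w != 0 /\
    exists2 e : R, 0 < e &
      forall x y, `|x| + `|y| < e -> O (expi t * (w + (x +i* y))).
  pose z := conjc (expi t) * z0.
  have Oz : O (expi t * z) by rewrite mulrA expi_conj mul1r.
  have [e e0 He] := open_rotated_box oO Oz.
  have [z1|z1] := eqVneq (complex.Im z) 0; last first.
    by exists z; split=> //; exists e.
  exists (z + (0 +i* (e / 2))); split.
    by rewrite raddfD /= z1 add0r gt_eqF// divr_gt0.
  exists (e / 2); first by rewrite divr_gt0.
  move=> x y xy; rewrite -addrA; apply: He => /=; rewrite add0r.
  have := ler_normD (e / 2) y.
  by rewrite (gtr0_norm (_ : 0 < e / 2)) ?divr_gt0//; lra.
have [r r0 [y0 wE]] := square_chart w0.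
(* If |y - y0| < 1, moving from y0 to y displaces the vector by at most
   c |y - y0|. *)
pose c := r * (2 * `|y0| + 3).
have c0 : 0 < c by rewrite mulr_gt0// addr_gt0 ?ltr_wpDl ?mulr_ge0.
pose eta := Num.min 1 (e / c).
have eta0 : 0 < eta by rewrite lt_min ltr01 divr_gt0.
have [|y /andP[y1 y2] Sy] := dS (y0 - eta) (y0 + eta); first by lra.
exists (expi t * (r%:C * (y -i* 1) ^+ 2)); split; last first.
  exists (chart t y) => //; apply/rayP; exists (r * (1 + y ^+ 2)).
    by rewrite mulr_ge0 ?addr_ge0 ?sqr_ge0// ltW.
  by rewrite mulrCA chartE mulrA -rmorphM.
have -> : r%:C * (y -i* 1) ^+ 2 = w +
    ((r * ((y - y0) * (y + y0))) +i* (- (2 * r * (y - y0)))).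
  by rewrite wE !expr2; by_coordinates; ring.
apply: He.
have yy : `|y - y0| < eta by rewrite ltr_norml; apply/andP; split; lra.
have [yy1 yye] : `|y - y0| < 1 /\ `|y - y0| < e / c.
  by apply/andP; rewrite -lt_min.
rewrite normrN !normrM (gtr0_norm r0) (_ : `|2| = 2) ?normr_nat//.
have y0y : `|y + y0| <= 2 * `|y0| + 1.
  have -> : y + y0 = (y - y0) + (y0 + y0) by ring.
  have := ler_normD (y - y0) (y0 + y0); have := ler_normD y0 y0.
  by move: yy1; lra.
move: yye; rewrite ltr_pdivlMr// /c => yye; apply: le_lt_trans yye.
move: y0y (normr_ge0 (y - y0)); move: (`|y - y0|) (`|y + y0|) => Y Z YZ Y0.
have -> : r * (Y * Z) + 2 * r * Y = Y * (r * (Z + 2)) by ring.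
by apply: ler_wpM2l => //; apply: ler_wpM2l; [exact: ltW|lra].
Qed.

(** * Orbits of directions *)

Section orbits.
Variables (R : realType) (K theta : R).
Hypothesis K1 : 1 < K.
Local Notation H := (Hmap K theta).
Local Notation Ht := (Htilde K theta).
Local Notation lam := (stretch K theta).
Local Notation d := (drift K theta).

Lemma ray_iter k phi z : ray phi z -> ray (iter k Ht phi) (iter k H z).
Proof.
elim: k => //= k IH /IH; move: (iter _ _ phi) (iter _ _ z) => psi w.
rewrite (circle_angle psi) (circle_angle (Ht _)); move: (repr psi) => s.
move=> /rayP[r r0 ->]; rewrite Hmap_scale.
have /(HtildeP theta K1)[q q0 ->] : Ht (angle s) = angle (repr (Ht (angle s))).
  exact: circle_angle.
apply/rayP; exists (r ^+ 2 * q); first by rewrite mulr_ge0 ?sqr_ge0// ltW.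
by rewrite [in RHS]rmorphM -[RHS]mulrA.
Qed.

Variable t : R.
Hypothesis tfix : Ht (angle t) = angle t.
Local Notation f := (boole (lam t) (d t)).

(** The pole stands for the direction opposite to t, which Htilde sends to t. *)
Lemma hits_pole_iter y n : iter n f y = 0 ->
  exists k, iter k Ht (chart t y) = angle t.
Proof.
elim: n y => [|n IH] y /=.
  by move=> ->; exists 1%N; rewrite /= Htilde_chart0.
have [-> _|y0] := eqVneq y 0; first by exists 1%N; rewrite /= Htilde_chart0.
by rewrite -iterS iterSr => /IH[k kE]; exists k.+1; rewrite iterSr Htilde_chart.
Qed.

Lemma iter_chart y n : (forall m, iter m f y != 0) ->
  iter n Ht (chart t y) = chart t (iter n f y).
Proof. by move=> nz; elim: n => //= n ->; rewrite Htilde_chart. Qed.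

(** Near infinity, 1/y is a coordinate for both signs of y at once. *)
Lemma chart_inv (y : R) : y != 0 -> chart t y = angle (t - 2 * atan y^-1).
Proof.
move=> y0; apply/angleP.
have yy : 0 < 1 + y ^+ 2 by rewrite ltr_pwDl// sqr_ge0.
have y2 : 0 < y ^+ 2 by rewrite exprn_even_gt0.
apply: (@expi_scale_inj _ (1 + y ^+ 2) (y ^+ 2 * (1 + y ^- 2))) => //.
  by rewrite mulr_gt0// ltr_pwDl// invr_ge0 sqr_ge0.
rewrite -chartE expiD [RHS]mulrCA; congr (_ * _).
have -> : expi (- (2 * atan y^-1)) = expi (atan (- y^-1)) ^+ 2.
  by rewrite -mulrN -atanN mulr_natl mulr2n expiD expr2.
have -> : (y ^+ 2 * (1 + y ^- 2))%:C =
    (y ^+ 2)%:C * (Num.sqrt (1 + (- y^-1) ^+ 2))%:C ^+ 2.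
  rewrite -rmorphXn sqr_sqrtr; first by rewrite sqrrN exprVn rmorphM.
  by rewrite addr_ge0// sqr_ge0.
rewrite -mulrA -exprMn -expi_atan rmorphXn -exprMn.
by congr (_ ^+ 2); by_coordinates; field.
Qed.

Lemma unbounded_basin y : (forall m, iter m f y != 0) ->
  orbit_unbounded (lam t) (d t) y ->
  iter n Ht (chart t y) @[n --> \oo] --> angle t.
Proof.
move=> nz un.
have -> : (fun n => iter n Ht (chart t y)) =
    (@angle R) \o (fun n => t - 2 * atan (iter n f y)^-1).
  by apply/funext => n; rewrite iter_chart// chart_inv.
have ac : {for t, continuous (@angle R)} by exact: pi_continuous.
apply: (@continuous_cvg _ _ _ _ _ _ (@angle R) _ ac).
have inv0 : (iter n f y)^-1 @[n --> \oo] --> (0 : R).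
  apply/cvgr0Pnorm_lt => e e0; have [N HN] := un e^-1.
  exists N => // n /= /HN; rewrite normfV => en.
  by rewrite -[e]invrK ltf_pV2 ?posrE ?invr_gt0// (lt_trans _ en)// invr_gt0.
have at0 : atan (iter n f y)^-1 @[n --> \oo] --> (0 : R).
  rewrite -[X in _ --> X](@atan0 R).
  exact: (continuous_cvg _ (@continuous_atan R 0) inv0).
rewrite -[X in _ --> X]subr0 -[X in _ - X](mulr0 2).
by apply: cvgB; [exact: cvg_cst|apply: cvgMr].
Qed.

Lemma hits_basin y n : iter n f y = 0 ->
  iter n Ht (chart t y) @[n --> \oo] --> angle t.
Proof.
move=> /hits_pole_iter[k kE].
have kn n' : iter (n' + k) Ht (chart t y) = angle t.
  by rewrite iterD kE; elim: n' => //= n' ->.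
apply: cvg_near_cst; exists k => // n' /= /subnK <-.
exact: kn.
Qed.

Lemma basin_dense : 1 <= lam t -> dense (basin K theta (angle t)).
Proof.
move=> l1; apply: (@dense_rays _ t) => a b ab.
have [y yab yH] := expanding_dense (d t) l1 ab.
exists y => //=; case: (pselect (exists n, iter n f y = 0)) => [[n]|nh].
  exact: hits_basin.
apply: unbounded_basin; last by case: yH.
by move=> m; apply/eqP => m0; apply: nh; exists m.
Qed.

Lemma preimages_dense :
  (forall a b, a < b -> exists2 y, a < y < b & exists n, iter n f y = 0) ->
  dense (\bigcup_(k in [set: nat]) (iter k H @^-1` ray (angle t))).
Proof.
move=> hits O O0 oO.
have [a b ab|z [Oz [phi [k kE] zphi]]] :=
    @dense_rays _ t [set phi | exists k, iter k Ht phi = angle t] _ O O0 oO.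
  by have [y yab [n /hits_pole_iter yn]] := hits a b ab; exists y.
exists z; split=> //; exists k => //=; rewrite -kE; exact: ray_iter.
Qed.

End orbits.

(** * Counting fixed directions *)

Lemma boole_root (R : realType) (lam d y : R) : lam != 0 ->
  (1 - lam) * y ^+ 2 - d * y + lam = 0 <-> y != 0 /\ boole lam d y = y.
Proof.
move=> l0; have E : y != 0 ->
    y * (y - boole lam d y) = (1 - lam) * y ^+ 2 - d * y + lam.
  by move=> y0; rewrite /boole; field.
have [->|y0] := eqVneq y 0.
  by rewrite expr0n !mulr0 subr0 add0r; split=> [/eqP|[]//]; rewrite (negPf l0).
rewrite -E//; split=> [/eqP|[_ ->]]; last by rewrite subrr mulr0.
by rewrite mulf_eq0 (negPf y0) subr_eq0 => /eqP yE; split.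
Qed.

(** For lam > 1 the discriminant d^2 + 4 lam (lam - 1) is positive, and for
    lam = 1 the equation is linear. *)
Lemma boole_no_root (R : realType) (lam d : R) : 0 < lam ->
  (forall y, (1 - lam) * y ^+ 2 - d * y + lam <> 0) ->
  lam = 1 /\ d = 0 \/ lam < 1 /\ d ^+ 2 < 4 * (lam * (1 - lam)).
Proof.
move=> l0 nr; have [l1|l1] := eqVneq lam 1.
  left; split=> //; apply/eqP/negPn/negP => d0; apply: (nr d^-1).
  by rewrite l1 subrr mul0r sub0r mulfV// addNr.
right; have ln1 : 1 - lam != 0 by rewrite subr_eq0 eq_sym.
have disc : d ^+ 2 < 4 * (lam * (1 - lam)).
  rewrite ltNge; apply/negP => D.
  pose r := Num.sqrt (d ^+ 2 - 4 * (lam * (1 - lam))).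
  have r2 : r ^+ 2 = d ^+ 2 - 4 * (lam * (1 - lam)).
    by rewrite sqr_sqrtr// subr_ge0.
  apply: (nr ((d + r) / (2 * (1 - lam)))).
  transitivity ((r ^+ 2 - (d ^+ 2 - 4 * (lam * (1 - lam)))) / (4 * (1 - lam))).
    by field.
  by rewrite r2 subrr mul0r.
split=> //; have := le_lt_trans (sqr_ge0 d) disc.
by rewrite pmulr_rgt0// pmulr_rgt0// subr_gt0.
Qed.

Lemma card_ge2 (T : pointedType) (A : set T) (n : nat) :
  A #= `I_n -> (1 < n)%N ->
  exists x y, [/\ A x, A y & x <> y].
Proof.
move=> /card_esym /card_set_bijP[g [gA ginj _]] n1.
exists (g 0%N), (g 1%N); split; [apply: gA => /=; exact: ltnW|exact: gA|].
by move=> /ginj; rewrite !inE /= => /(_ (ltnW n1) n1).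
Qed.

Section fixed_rays.
Variables (R : realType) (K theta : R).
Hypothesis K1 : 1 < K.
Local Notation Ht := (Htilde K theta).
Local Notation lam := (stretch K theta).
Local Notation d := (drift K theta).

Lemma fixed_chart_stretch t y : Ht (angle t) = angle t ->
  (1 - lam t) * y ^+ 2 - d t * y + lam t = 0 ->
  Ht (chart t y) = chart t y /\
  lam (t + pi + 2 * atan y) = y ^+ 2 / (lam t * (1 + y ^+ 2)).
Proof.
move=> tfix /boole_root[|y0 fy]; first by rewrite gt_eqF// stretch_gt0.
by split; [apply/fixed_chartP|exact: stretch_chart].
Qed.

Lemma fixed_other t phi : Ht (angle t) = angle t -> Ht phi = phi ->
  phi <> angle t ->
  exists2 y, phi = chart t y & (1 - lam t) * y ^+ 2 - d t * y + lam t = 0.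
Proof.
move=> tfix pfix /eqP pt; have [y yE] := chart_surj pt; exists y => //.
apply/boole_root; first by rewrite gt_eqF// stretch_gt0.
by apply/(fixed_chartP K1 tfix); rewrite -yE.
Qed.

(** The numbers stretch of two distinct fixed directions have product
    y^2 / (1 + y^2) < 1. *)
Lemma other_repelling t phi : Ht (angle t) = angle t -> 1 <= lam t ->
  Ht phi = phi -> phi <> angle t -> locally_repelling K theta phi.
Proof.
move=> tfix l1 pfix pt; have [y yE yr] := fixed_other tfix pfix pt.
have [_ ls] := fixed_chart_stretch tfix yr.
rewrite yE; apply/(locally_repellingP K1); first by rewrite -/(chart t y) -yE.
have yy : 0 < 1 + y ^+ 2 by rewrite ltr_pwDl// sqr_ge0.
rewrite ls ltr_pdivrMr ?mul1r; last by rewrite mulr_gt0// (lt_le_trans _ l1).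
by rewrite (lt_le_trans (_ : y ^+ 2 < 1 + y ^+ 2))// ?ltrDr// ler_peMl// ltW.
Qed.

(** The two roots of the quadratic have product lam / (1 - lam), so one of them
    has square at least lam / (1 - lam), and this inequality says that the
    corresponding direction has stretch at least 1. *)
Lemma exists_nonrepelling (phi psi : circle R) : Ht phi = phi -> Ht psi = psi ->
  phi <> psi -> exists2 t, Ht (angle t) = angle t & 1 <= lam t.
Proof.
rewrite (circle_angle psi); move: (repr psi) => t pfix tfix pt.
have [l1|l1] := leP 1 (lam t); first by exists t.
have l0 : 0 < lam t by exact: stretch_gt0.
have [y _ yr] := fixed_other tfix pfix pt.
have y0 : y != 0.
  apply/eqP => y0; move: yr; rewrite y0 expr0n !mulr0 subr0 add0r => /eqP.
  by rewrite gt_eqF.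
have [z zr zl] : exists2 z, (1 - lam t) * z ^+ 2 - d t * z + lam t = 0 &
    lam t <= (1 - lam t) * z ^+ 2.
  have [yl|yl] := leP (lam t) ((1 - lam t) * y ^+ 2); first by exists y.
  have l1' : 0 < 1 - lam t by rewrite subr_gt0.
  have y2 : 0 < y ^+ 2 by rewrite exprn_even_gt0.
  exists (lam t / ((1 - lam t) * y)).
    transitivity (lam t / ((1 - lam t) * y ^+ 2) *
        ((1 - lam t) * y ^+ 2 - d t * y + lam t)); last by rewrite yr mulr0.
    by field; rewrite y0 gt_eqF.
  have -> : (1 - lam t) * (lam t / ((1 - lam t) * y)) ^+ 2 =
      lam t * (lam t / ((1 - lam t) * y ^+ 2)) by field; rewrite y0 gt_eqF.
  rewrite ler_peMr ?(ltW l0)// ler_pdivlMr; last exact: mulr_gt0.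
  by rewrite mul1r ltW.
have [zfix zs] := fixed_chart_stretch tfix zr.
exists (t + pi + 2 * atan z) => //; rewrite zs.
have zz : 0 < 1 + z ^+ 2 by rewrite ltr_pwDl// sqr_ge0.
rewrite ler_pdivlMr; last exact: mulr_gt0.
by rewrite mul1r; lra.
Qed.

End fixed_rays.

End complex_plane.

Theorem theorem2p3 (R : realType) (K theta : R)
    (hK : 1 < K) (htheta : - (pi / 2) < theta <= pi / 2) :
  (forall phi : circle R, fixed_rays K theta = [set ray phi] ->
     dense (\bigcup_(k in [set: nat]) (iter k (Hmap K theta) @^-1` ray phi))) /\
  (fixed_rays K theta #= `I_2 \/ fixed_rays K theta #= `I_3 ->
     exists phi0 : circle R,
       [/\ Htilde K theta phi0 = phi0, ~ locally_repelling K theta phi0,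
           (forall phi : circle R, Htilde K theta phi = phi ->
              ~ locally_repelling K theta phi -> phi = phi0)
         & dense (basin K theta phi0)]).
Proof.
split=> [phi one|many].
  have uniq psi : Htilde K theta psi = psi -> psi = phi.
    move=> pfix; have : fixed_rays K theta (ray psi) by exists psi.
    by rewrite one => /ray_inj.
  have tfix : Htilde K theta phi = phi.
    have : fixed_rays K theta (ray phi) by rewrite one.
    by case=> psi /= pfix /ray_inj <-.
  move: tfix uniq; rewrite (circle_angle phi); move: (repr phi) => t tfix uniq.
  have l0 := stretch_gt0 theta hK t.
  apply: (preimages_dense hK tfix) => a b ab.
  have [y /(fixed_chart_stretch hK tfix)[/uniq/chart_neq]//|[l1 d0]|[l1 disc]] :=
    boole_no_root l0 (d := drift K theta t).
    rewrite l1 d0.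
    have [y yab yH] := expanding_dense 0 (lexx 1) ab; exists y => //.
    apply: contrapT => nh; case: yH => //; apply: triple_bounded => n.
    by apply/eqP => n0; apply: nh; exists n.
  exact: elliptic_dense.
have [phi [psi [pfix qfix pq]]] : exists phi psi,
    [/\ Htilde K theta phi = phi, Htilde K theta psi = psi & phi <> psi].
  have [A [B [[phi pfix <-] [psi qfix <-] AB]]] :
      exists A B, [/\ fixed_rays K theta A, fixed_rays K theta B & A <> B].
    by case: many => /card_ge2; apply.
  by exists phi, psi; split=> // pq; apply: AB; rewrite pq.
have [t tfix l1] := exists_nonrepelling hK pfix qfix pq.
exists (angle t); split=> //.
- by move/(locally_repellingP hK tfix); rewrite ltNge l1.
- move=> chi cfix; apply: contra_notP; exact: (other_repelling hK tfix l1 cfix).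
- exact: basin_dense.
Qed.
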